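(* Let $X$ be a locally convex space and let a net of logarithmically concave measures $\mu_\alpha$ on $X$ converge weakly to a Radon measure $\mu$. Then for every continuous seminorm $q$ on $X$ there is $\kappa>0$ such that $$\lim_\alpha\int_X\exp(\kappa q)\,d\mu_\alpha=\int_X\exp(\kappa q)\,d\mu.$$ Therefore, for every continuous seminorm $q$ and every $r>0$ we have $$\lim_\alpha\int_X q^r\,d\mu_\alpha=\int_X q^r\,d\mu.$$ Finally, if the measures $\mu_\alpha$ and $\mu$ have barycenters, then $m_{\mu_\alpha}\to m_\mu$ in $X$.
   Context: Locally convex spaces are real and Hausdorff. A finite nonnegative Borel measure $\mu$ is Radon if for every Borel set $B$ and $\varepsilon>0$ there is a compact $K\subset B$ with $\mu(B\setminus K)<\varepsilon$. A Radon probability measure $\mu$ on $X$ is logarithmically concave if $\mu(tA+(1-t)B)\ge\mu(A)^t\mu(B)^{1-t}$ for all compact sets $A,B$ and all $t\in(0,1)$. Equivalently, for every continuous linear operator $T\colon X\to\mathbb{R}^n$ the image measure $\mu\circ T^{-1}$ has a density of the form $\exp(-V)$, with $V$ convex, with respect to Lebesgue measure on some affine subspace. Weak convergence means convergence of the integrals of every bounded continuous function. A measure $\mu$ has a barycenter $m_\mu\in X$ if $X^*\subset L^1(\mu)$ and $f(m_\mu)=\int_X f\,d\mu$ for every $f\in X^*$. *)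

(* Defs.v *)
From HB Require Import structures.
From mathcomp Require Import all_boot all_order all_algebra.
From mathcomp Require Import all_classical all_reals all_analysis.

Set Implicit Arguments.
Unset Strict Implicit.
Unset Printing Implicit Defensive.

Import Order.TTheory GRing.Theory Num.Theory.
Import numFieldNormedType.Exports.

Local Open Scope classical_set_scope.
Local Open Scope ring_scope.

(* A [tvsType] (locally convex space) does not inherit from [pointedType], which
   [g_sigma_algebraType] requires; this alias of [X] is pointed by 0. *)
Definition pointed_tvs (R : numDomainType) (X : tvsType R) : Type := X.
HB.instance Definition _ (R : numDomainType) (X : tvsType R) :=
  Choice.on (pointed_tvs X).
HB.instance Definition _ (R : numDomainType) (X : tvsType R) :=
  isPointed.Build (pointed_tvs X) (0 : X).

Definition borel (R : numDomainType) (X : tvsType R) : measurableType _ :=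
  g_sigma_algebraType (@open X : set (set (pointed_tvs X))).

Definition directed (disp : Order.disp_t) (I : preorderType disp) :=
  inhabited I /\ forall i j : I, exists k : I, (i <= k)%O /\ (j <= k)%O.

(* The filter of tails: [u @ net_filter I --> l] is convergence of the net. *)
Definition net_filter (disp : Order.disp_t) (I : preorderType disp) :
    set_system I :=
  filter_from setT (fun i : I => [set j : I | (i <= j)%O]).
Arguments net_filter {disp} I _.

Section measures_on_tvs.
Context (R : realType) (X : tvsType R).

Definition seminorm (q : X -> R) :=
  (forall x y, q (x + y) <= q x + q y) /\
  (forall (a : R) x, q (a *: x) = `|a| * q x).

(* The sets [K] and [A], [B] below are compact in [X]; in a Hausdorff space
   compact sets, and [t A + (1 - t) B], are closed, hence Borel. *)
Definition radon (mu : {finite_measure set (borel X) -> \bar R}) :=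
  forall (B : set (borel X)) (e : R), measurable B -> 0 < e ->
  exists K : set X, [/\ compact K, K `<=` B & (mu (B `\` K) < e%:E)%E].

Definition log_concave (mu : probability (borel X) R) :=
  radon mu /\
  forall (A B : set X) (t : R), compact A -> compact B -> 0 < t < 1 ->
  (mu A `^ t * mu B `^ (1 - t)
     <= mu [set (t *: a + (1 - t) *: b)%R | a in A & b in B])%E.

Definition weak_cvg (disp : Order.disp_t) (I : preorderType disp)
    (mu_ : I -> {finite_measure set (borel X) -> \bar R})
    (mu : {finite_measure set (borel X) -> \bar R}) :=
  forall f : X -> R, continuous f -> bounded_fun f ->
  \int[mu_ i]_x f x @[i --> net_filter I] --> \int[mu]_x f x.

Definition barycenter (mu : {finite_measure set (borel X) -> \bar R}) (m : X) :=
  forall f : {scalar X}, continuous f ->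
  mu.-integrable setT (fun x => (f x)%:E) /\ f m = \int[mu]_x f x.

End measures_on_tvs.

(* Main.v *)
(* Borell's inequality: if a logarithmically concave probability gives mass at
   most 1/4 to {q > c}, then, since K1 / (k+1) + k K2 / (k+1) lies in {q > c}
   for K1 in {q > (2k+1) c} and K2 in {q <= c}, it gives mass at most
   2^-(k+1) to {q > (2k+1) c}. Weak convergence provides one c for all large
   indices, hence a uniform bound on the integrals of exp(kappa q); testing
   weak convergence on truncations of h and bounding the error by h^2 / N
   then yields convergence of the integrals of h for every h with uniformly
   bounded second moments.

   For barycenters, q(m_i - m) = f(m_i) - f(m) for some linear f <= q
   (Hahn-Banach), so it suffices that the integrals of f converge uniformly
   over all such f. On a compact set carrying almost all of the limit, f is
   uniformly approximated by a combination of finitely many functions of a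
   partition of unity that do not depend on f, with coefficients f(y)
   bounded by q(y). *)
Require Import Defs.
From HB Require Import structures.
From mathcomp Require Import all_boot all_order all_algebra.
From mathcomp Require Import all_classical all_reals all_analysis.
From mathcomp Require Import measurable_realfun ring lra.

Import Order.TTheory GRing.Theory Num.Theory.
Import numFieldNormedType.Exports.

Local Open Scope classical_set_scope.
Local Open Scope ring_scope.


(** * Sublinear functionals and the Hahn-Banach theorem *)

Section sublinear.
Context {R : realType} {V : lmodType R}.
Implicit Types (p : V -> R) (x y : V).

Definition sublinear p :=
  (forall x y, p (x + y) <= p x + p y) /\
  (forall (a : R) x, 0 <= a -> p (a *: x) = a * p x).

Lemma sublinear0 p : sublinear p -> p 0 = 0.
Proof. by case=> _ pZ; rewrite -(scale0r 0) pZ// mul0r. Qed.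

Lemma sublinearN p x : sublinear p -> - p (- x) <= p x.
Proof.
move=> sp; have [pD _] := sp.
by rewrite lerNl -subr_ge0 opprK -(sublinear0 _ sp) -(addNr x) pD.
Qed.

(** The reverse inequality is the assumed one with factor [a^-1] at the point [a *: x]. *)
Lemma sublinear_of_le p : p 0 = 0 ->
  (forall x y, p (x + y) <= p x + p y) ->
  (forall (a : R) x, 0 < a -> p (a *: x) <= a * p x) -> sublinear p.
Proof.
move=> p0 pD pZ; split=> // a x; rewrite le_eqVlt => /predU1P[<-|a0].
  by rewrite scale0r mul0r.
apply/eqP; rewrite eq_le pZ//= -ler_pdivlMl//.
by rewrite -[in leLHS](scale1r x) -(mulVf (lt0r_neq0 a0)) -scalerA pZ// invr_gt0.
Qed.

(** The modification of [p] that becomes additive in the direction [y]; a sublinear functional that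
    no such modification lowers is linear. *)
Definition descent p y x : R :=
  inf [set p (x + t *: y) - t * p y | t in [set t : R | 0 <= t]].

(** Comes from [t *: y = (x + t *: y) + (- x)] and subadditivity. It makes the infimum in [descent]
    a genuine one. *)
Lemma descent_lb p y x (t : R) : sublinear p -> 0 <= t ->
  - p (- x) <= p (x + t *: y) - t * p y.
Proof.
move=> [pD pZ] t0; rewrite -pZ// lerBrDr addrC lerBlDr.
by rewrite -[in leLHS](addrK x (t *: y)) [_ + x]addrC pD.
Qed.

Lemma descent_has_lbound p y x : sublinear p ->
  has_lbound [set p (x + t *: y) - t * p y | t in [set t : R | 0 <= t]].
Proof. by move=> sp; exists (- p (- x)) => _ [t t0 <-]; exact: descent_lb. Qed.

Lemma descent_le p y x (t : R) : sublinear p -> 0 <= t ->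
  descent p y x <= p (x + t *: y) - t * p y.
Proof.
by move=> sp t0; apply: ge_inf; [exact: descent_has_lbound|exists t].
Qed.

Lemma descent_ge p y x b :
  (forall t : R, 0 <= t -> b <= p (x + t *: y) - t * p y) -> b <= descent p y x.
Proof.
move=> bp; apply: lb_le_inf; first by exists (p (x + 0 *: y) - 0 * p y); exists 0 => /=.
by move=> _ [t t0 <-]; exact: bp.
Qed.

Lemma descent_le_self p y x : sublinear p -> descent p y x <= p x.
Proof.
move=> sp; apply: le_trans (descent_le _ y x _ sp (lexx 0)) _.
by rewrite scale0r addr0 mul0r subr0.
Qed.

(** Parameters [t] at [x] and [s] at [x'] combine into [t + s] at [x + x']; for homogeneity the
    parameter is rescaled by [a]. *)
Lemma sublinear_descent p y : sublinear p -> sublinear (descent p y).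
Proof.
move=> sp; have [pD pZ] := sp; apply: sublinear_of_le.
- apply/eqP; rewrite eq_le; apply/andP; split.
    by apply: le_trans (descent_le_self _ _ _ sp) _; rewrite (sublinear0 _ sp).
  apply: descent_ge => t t0.
  by apply: le_trans (descent_lb _ y 0 _ sp t0); rewrite oppr0 (sublinear0 _ sp) oppr0.
- move=> x x'; rewrite -lerBlDl; apply: descent_ge => s s0.
  rewrite lerBlDr -lerBlDl; apply: descent_ge => t t0; rewrite lerBlDl.
  have := descent_le p y (x + x') (t + s) sp (addr_ge0 t0 s0).
  rewrite scalerDl addrACA; have := pD (x + t *: y) (x' + s *: y); lra.
- move=> a x a0; rewrite -ler_pdivrMl//; apply: descent_ge => t t0.
  rewrite ler_pdivrMl//.
  apply: le_trans (descent_le _ y (a *: x) _ sp (mulr_ge0 (ltW a0) t0)) _.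
  by rewrite -scalerA -scalerDr (pZ _ _ (ltW a0)) mulrBr mulrA.
Qed.

(** Supplies the bound of a chain for Zorn's lemma. Comparability gives subadditivity: of the
    members chosen at [x] and at [y], the smaller one serves at both points. *)
Lemma sublinear_inf p (C : set (V -> R)) : sublinear p -> C !=set0 ->
  (forall f, C f -> sublinear f /\ forall x, f x <= p x) ->
  (forall f g, C f -> C g -> (forall x, f x <= g x) \/ (forall x, g x <= f x)) ->
  let g x := inf [set f x | f in C] in
  sublinear g /\ forall f x, C f -> g x <= f x.
Proof.
move=> sp [f0 Cf0] Csub Ctot g.
have lb x : has_lbound [set f x | f in C].
  exists (- p (- x)) => _ [f Cf <-]; have [sf fp] := Csub _ Cf.
  by apply: le_trans (sublinearN _ x sf); rewrite lerN2.
have gle f x : C f -> g x <= f x by move=> Cf; apply: ge_inf => //; exists f.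
have gge x b : (forall f, C f -> b <= f x) -> b <= g x.
  move=> bf; apply: lb_le_inf; first by exists (f0 x); exists f0.
  by move=> _ [f Cf <-]; exact: bf.
split=> //; apply: sublinear_of_le.
- apply/eqP; rewrite eq_le; apply/andP; split.
    by rewrite (le_trans (gle f0 _ Cf0))// sublinear0//; case: (Csub _ Cf0).
  by apply/gge => f /Csub[sf _]; rewrite sublinear0.
- move=> x y; rewrite -lerBlDl; apply/gge => f Cf.
  rewrite lerBlDr -lerBlDl; apply/gge => h Ch; rewrite lerBlDl.
  have [[fD _] _] := Csub _ Cf; have [[hD _] _] := Csub _ Ch.
  have [fh|hf] := Ctot _ _ Cf Ch.
    by rewrite addrC (le_trans (gle f _ Cf))// (le_trans (fD _ _))// lerD2l.
  by rewrite addrC (le_trans (gle h _ Ch))// (le_trans (hD _ _))// lerD2r.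
- move=> a x a0; rewrite -ler_pdivrMl//; apply/gge => f Cf.
  have [[_ fZ] _] := Csub _ Cf.
  by rewrite ler_pdivrMl// (le_trans (gle f _ Cf))// (fZ _ _ (ltW a0)).
Qed.

Lemma minimal_sublinear p : sublinear p -> exists f, [/\ sublinear f,
  forall x, f x <= p x &
  forall g, sublinear g -> (forall x, g x <= f x) -> g = f].
Proof.
move=> sp.
pose T := {f : V -> R | sublinear f /\ forall x, f x <= p x}.
(* The pointwise order is reversed, so that a maximal element for [r] is a minimal functional. *)
pose r (f g : T) := `[< forall x, sval g x <= sval f x >].
have Tinj (f g : T) : sval f = sval g -> f = g.
  by case: f g => [f hf] [g hg] /= fg; subst g; congr exist; exact: Prop_irrelevance.
have [|||A Atot|[f [sf fp]] fmin] := @Zorn T r.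
- by move=> t; apply/asboolP.
- move=> f g h /asboolP fg /asboolP gh; apply/asboolP => x.
  exact: le_trans (gh x) (fg x).
- move=> f g /asboolP fg /asboolP gf; apply: Tinj; apply/funext => x.
  by apply/eqP; rewrite eq_le fg gf.
- have [[f0 Af0]|A0] := pselect (A !=set0); last first.
    by exists (exist _ p (conj sp (fun x => lexx (p x)))) => s As; case: A0; exists s.
  pose C := [set sval f | f in A].
  have [|||sg gle] := @sublinear_inf p C sp.
  + by exists (sval f0); exists f0.
  + by move=> _ [f _ <-]; exact: svalP f.
  + move=> _ _ [f Af <-] [g Ag <-].
    by have [/asboolP|/asboolP] := Atot _ _ Af Ag; [right|left].
  set g := fun x => _ in sg gle.
  have gp x : g x <= p x.
    by apply: le_trans (gle (sval f0) x _) _; [exists f0|case: (svalP f0)].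
  exists (exist _ g (conj sg gp)) => s As; apply/asboolP => x /=.
  by apply: gle; exists s.
- exists f; split=> // g sg gf.
  have gp x : g x <= p x by exact: le_trans (gf x) (fp x).
  by have /(congr1 sval) := fmin (exist _ g (conj sg gp)) (asboolT gf).
Qed.

(* A minimal sublinear [f] equals all its [descent f y], which forces
   [f (x + y) = f x + f y]. *)
Lemma hahn_banach p x0 : sublinear p ->
  exists f : {scalar V}, (forall x, f x <= p x) /\ f x0 = p x0.
Proof.
move=> sp.
(* Starting from [descent p x0] instead of [p] fixes the value at [x0]: at [- x0] the choice [t = 1]
   bounds it by [- p x0]. *)
have [f [sf fp fmin]] := minimal_sublinear _ (sublinear_descent _ x0 sp).
have [fsD fZ] := sf.
have fD x y : f (x + y) = f x + f y.
  apply/eqP; rewrite eq_le fsD/=.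
  have eqf := fmin _ (sublinear_descent _ y sf) (fun x => descent_le_self _ y x sf).
  have := descent_le f y x 1 sf ler01.
  by rewrite eqf scale1r mul1r lerBrDr.
have f0 := sublinear0 _ sf.
have fN x : f (- x) = - f x by apply/eqP; rewrite -subr_eq0 opprK -fD addNr f0.
have flin : linear_for *%R f.
  move=> a x y; rewrite fD; congr (_ + _).
  have [a0|a0] := leP 0 a; first exact: fZ.
  by rewrite -[a]opprK scaleNr fN fZ -?mulNr// oppr_ge0 ltW.
pose fl : {scalar V} := HB.pack f (GRing.isLinear.Build _ _ _ _ f flin).
exists fl; split=> [x|]; first exact: le_trans (fp x) (descent_le_self _ _ _ sp).
apply/eqP; rewrite eq_le (le_trans (fp x0) (descent_le_self _ _ _ sp))/=.
have := le_trans (fp (- x0)) (descent_le _ x0 (- x0) _ sp ler01).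
by rewrite scale1r addNr sublinear0// mul1r sub0r fN lerN2.
Qed.

End sublinear.

(** * Continuous seminorms, Minkowski functionals and neighbourhoods of 0 *)

Section seminorms.
Context {R : realType} {X : tvsType R}.
Implicit Types (q : X -> R) (U : set X).

Lemma cvgB_tvs {T : Type} {F : set_system T} {FF : Filter F} (f g : T -> X) x y :
  f @ F --> x -> g @ F --> y -> f t - g t @[t --> F] --> x - y.
Proof.
exact: (@continuous2_cvg _ X X X F FF f g (fun u v => u - v) _ _
  (@sub_continuous X (x, y))).
Qed.

Lemma cvgD_tvs {T : Type} {F : set_system T} {FF : Filter F} (f g : T -> X) x y :
  f @ F --> x -> g @ F --> y -> f t + g t @[t --> F] --> x + y.
Proof.
exact: (@continuous2_cvg _ X X X F FF f g (fun u v => u + v) _ _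
  (@add_continuous X (x, y))).
Qed.

Lemma cvgZ_tvs {T : Type} {F : set_system T} {FF : Filter F}
    (k : T -> R) (f : T -> X) (a : R) (x : X) :
  k @ F --> a -> f @ F --> x -> k t *: f t @[t --> F] --> a *: x.
Proof.
exact: (@continuous2_cvg _ R^o X X F FF k f (fun u v => u *: v) _ _
  (@scale_continuous R X (a, x))).
Qed.

Lemma seminorm0 q : seminorm q -> q 0 = 0.
Proof. by case=> _ qZ; rewrite -(scale0r 0) qZ normr0 mul0r. Qed.

Lemma seminormN q x : seminorm q -> q (- x) = q x.
Proof. by case=> _ qZ; rewrite -scaleN1r qZ normrN1 mul1r. Qed.

Lemma seminorm_ge0 q x : seminorm q -> 0 <= q x.
Proof.
move=> sq; have [qD _] := sq.
have := qD x (- x); rewrite subrr (seminorm0 _ sq) (seminormN _ _ sq).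
by rewrite -mulr2n pmulrn_lge0.
Qed.

Lemma seminorm_sublinear q : seminorm q -> sublinear q.
Proof. by case=> qD qZ; split=> // a x a0; rewrite qZ ger0_norm. Qed.

Lemma seminorm_dist q x y : seminorm q -> `|q x - q y| <= q (x - y).
Proof.
move=> sq; have [qD _] := sq; rewrite ler_norml.
have := qD (x - y) y; have := qD (y - x) x; rewrite !subrK.
rewrite -(opprB x y) seminormN// => h1 h2; lra.
Qed.

(** By the reverse triangle inequality it is enough that [q (x - y)] be small, and this holds on a
    rescaled copy of the given neighbourhood. *)
Lemma continuous_seminorm q : seminorm q ->
  nbhs (0 : X) [set x | q x <= 1] -> continuous q.
Proof.
move=> sq q1 x; apply/cvgrPdist_le => e e0; have [_ qZ] := sq.
have : e^-1 *: (x - y) @[y --> x] --> e^-1 *: (x - x).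
  apply: (cvgZ_tvs (fun=> e^-1) (fun y => x - y)); first exact: cvg_cst.
  by apply: (cvgB_tvs (fun=> x) id); [exact: cvg_cst|exact: cvg_id].
rewrite subrr scaler0 => /(_ _ q1); apply: (@filterS _ (nbhs x) _) => y /=.
rewrite qZ gtr0_norm ?invr_gt0// ler_pdivrMl// mulr1.
by apply: le_trans; exact: seminorm_dist.
Qed.

Lemma norm_dominated q (f : {scalar X}) x : seminorm q ->
  (forall x, f x <= q x) -> `|f x| <= q x.
Proof.
move=> sq fq; rewrite ler_norml fq andbT lerNl -linearN/=.
by rewrite (le_trans (fq _))// seminormN.
Qed.

Lemma continuous_dominated q (f : {scalar X}) : seminorm q -> continuous q ->
  (forall x, f x <= q x) -> continuous f.
Proof.
move=> sq cq fq x; apply/cvgrPdist_le => e e0.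
have : q (x - y) @[y --> x] --> q (x - x).
  apply: continuous_cvg; first exact: cq.
  by apply: (cvgB_tvs (fun=> x) id); [exact: cvg_cst|exact: cvg_id].
rewrite subrr seminorm0// => /cvgrPdist_le/(_ _ e0); apply: (@filterS _ (nbhs x) _) => y /=.
rewrite sub0r normrN ger0_norm ?seminorm_ge0//; apply: le_trans.
rewrite -linearB; exact: norm_dominated.
Qed.

Lemma nbhs0_absorb U x : nbhs (0 : X) U -> exists2 r : R, 0 < r & U (r *: x).
Proof.
move=> U0; have : r *: x @[r --> (0 : R)] --> (0 : R) *: x.
  by apply: (cvgZ_tvs id (fun=> x)); [exact: cvg_id|exact: cvg_cst].
rewrite scale0r => /(_ _ U0)/nbhs_ballP[e /= e0 eU].
exists (e / 2); first by rewrite divr_gt0.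
by apply: eU; rewrite /ball/= sub0r normrN gtr0_norm ?divr_gt0// gtr_pMr// invf_lt1// ltr1n.
Qed.

(** The Minkowski functional of [U]. *)
Definition gauge U x : R := inf [set s : R | 0 < s /\ U (s^-1 *: x)].

Definition absconvex U :=
  (forall x y (t : R), 0 <= t <= 1 -> U x -> U y -> U (t *: x + (1 - t) *: y)) /\
  (forall x, U x -> U (- x)).

(** Absorption makes the infimum run over a nonempty set, convexity yields the triangle inequality,
    and symmetry upgrades positive homogeneity to absolute homogeneity. *)
Lemma seminorm_gauge U : absconvex U -> nbhs (0 : X) U ->
  [/\ seminorm (gauge U), (forall x, U x -> gauge U x <= 1) &
      forall x, gauge U x < 1 -> U x].
Proof.
move=> [Uconv UN] U0; have U00 : U 0 := nbhs_singleton U0.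
have S0 x : [set s : R | 0 < s /\ U (s^-1 *: x)] !=set0.
  by have [r r0 Ur] := nbhs0_absorb _ x U0; exists r^-1; rewrite /= invr_gt0 invrK.
have Slb x : has_lbound [set s : R | 0 < s /\ U (s^-1 *: x)].
  by exists 0 => s [/ltW].
have gle x s : 0 < s -> U (s^-1 *: x) -> gauge U x <= s by move=> s0 Us; exact: ge_inf.
have gge x b : (forall s, 0 < s -> U (s^-1 *: x) -> b <= s) -> b <= gauge U x.
  by move=> h; apply: lb_le_inf => // s [s0 Us]; exact: h.
have ge0 x : 0 <= gauge U x by apply/gge => s /ltW.
have g1 x : gauge U x < 1 -> U x.
  move=> x1; have [s [s0 Us] s1] := inf_lt (S0 x) x1.
  have -> : x = s *: (s^-1 *: x) + (1 - s) *: 0.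
    by rewrite scaler0 addr0 scalerA divff ?scale1r ?gt_eqF.
  by apply: Uconv => //; rewrite !ltW.
split=> //; last by move=> x Ux; apply/gle => //; rewrite invr1 scale1r.
have sub : sublinear (gauge U).
  apply: sublinear_of_le.
  - apply/eqP; rewrite eq_le ge0 andbT; apply/ler_addgt0Pl => e e0; rewrite addr0.
    by apply/gle => //; rewrite scaler0.
  - move=> x y; rewrite -lerBlDl; apply/gge => s s0 Us.
    rewrite lerBlDr -lerBlDl; apply/gge => t t0 Ut; rewrite lerBlDl [s + t]addrC.
    have st0 : 0 < t + s by rewrite addr_gt0.
    apply/gle => //.
    (* The rescaled sum is a convex combination of two points of [U], with weights proportional to
       [t] and [s]. *)
    have -> : (t + s)^-1 *: (x + y) =
        (t / (t + s)) *: (t^-1 *: x) + (1 - t / (t + s)) *: (s^-1 *: y).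
      rewrite !scalerA scalerDr; congr (_ *: _ + _ *: _);
        by field; rewrite !gt_eqF.
    apply: Uconv => //; rewrite divr_ge0 ?(ltW t0) ?(ltW st0)//=.
    by rewrite ler_pdivrMr// mul1r lerDl ltW.
  - move=> a x a0; rewrite -ler_pdivrMl//; apply/gge => s s0 Us.
    rewrite ler_pdivrMl//; apply/gle; first by rewrite mulr_gt0.
    by rewrite scalerA invfM mulrAC mulVf ?mul1r// gt_eqF.
have [gD gZ] := sub; split=> // a x.
have gN y : gauge U (- y) = gauge U y.
  rewrite /gauge; congr inf; apply/seteqP.
  by split=> s [s0 /UN]; rewrite -scalerN ?opprK => Us; split.
have [a0|a0] := ger0P a; first exact: gZ.
by rewrite -(opprK a) scaleNr gN gZ ?opprK// oppr_ge0 ltW.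
Qed.

Lemma seminorm_basis U : nbhs (0 : X) U ->
  exists q, [/\ seminorm q, continuous q & [set x | q x < 1] `<=` U].
Proof.
move=> U0; have [B Bconv [Bo Bb]] := @locally_convex R X.
have [b [Bbb b0] bU] := Bb 0 U U0.
have nb : nbhs (0 : X) b by exact: open_nbhs_nbhs (conj (Bo _ Bbb) b0).
(* A basic convex neighbourhood need not be symmetric; intersecting it with its reflection makes it
   so. *)
pose W : set X := b `&` [set x | b (- x)].
have W0 : nbhs (0 : X) W.
  apply: filterI => //; have := @opp_continuous X 0.
  by rewrite /continuous_at oppr0 => /(_ _ nb).
have Wac : absconvex W.
  split=> [x y t /andP[t0 t1] [bx bNx] [by_ bNy]|x [bx bNx]]; last first.
    by split; rewrite //= opprK.
  have bc (u v : X) : b u -> b v -> b (t *: u + (1 - t) *: v).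
    move=> bu bv; have /Bconv/(_ u v (Itv01 t0 t1)) : b \in B by exact: mem_set.
    by rewrite !inE; exact.
  by split; rewrite /= ?opprD -?scalerN; exact: bc.
have [sg g1 gW] := seminorm_gauge _ Wac W0.
exists (gauge W); split=> //; last by move=> x /gW [/bU].
by apply: continuous_seminorm => //; apply: filterS W0.
Qed.

End seminorms.

(** * Borel measurability of open and closed sets and of continuous functions *)

Section borel_measures.
Context {R : realType} {X : tvsType R}.
Implicit Types (q : X -> R).

Lemma open_borel (U : set X) : open U -> measurable (U : set (borel X)).
Proof. exact: sub_sigma_algebra. Qed.

Lemma closed_borel (U : set X) : closed U -> measurable (U : set (borel X)).
Proof.
move=> cU; rewrite -[U]setCK; apply: measurableC.
apply: open_borel; exact: closed_openC.
Qed.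

Lemma continuous_borel (f : X -> R) : continuous f ->
  measurable_fun setT (f : borel X -> R).
Proof.
move=> /continuousP cf; apply: (measurability _ (RGenOpens.measurableE R)).
move=> _ [_ [a [b ->] <-]]; rewrite setTI; apply: open_borel.
exact/cf/interval_open.
Qed.

Lemma borel_gt (f : X -> R) c : continuous f ->
  measurable ([set x | c < f x] : set (borel X)).
Proof.
move=> /continuousP cf; apply: open_borel.
have -> : [set x | c < f x] = f @^-1` `]c, +oo[.
  by apply/seteqP; split=> x /=; rewrite in_itv/= andbT.
exact/cf/interval_open.
Qed.

Lemma borel_le (f : X -> R) c : continuous f ->
  measurable ([set x | f x <= c] : set (borel X)).
Proof.
move=> cf; rewrite (_ : [set x | _] = ~` [set x | c < f x]).
  apply: measurableC; exact: borel_gt.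
by apply/seteqP; split=> x /=; [rewrite leNgt => /negP|move/negP; rewrite -leNgt].
Qed.

End borel_measures.

Lemma integral_indicT {d} {T : measurableType d} {R : realType}
    (mu : {measure set T -> \bar R}) (A : set T) :
  measurable A -> (\int[mu]_x (\1_A x)%:E)%E = mu A.
Proof. by move=> mA; rewrite integral_indic// setIT. Qed.

(** * Bounding integrals through truncations *)

Section truncation.
Context {d : measure_display} {T : measurableType d} {R : realType}.
Local Open Scope ereal_scope.

(** Monotone convergence: at each point the truncations equal [h] from some index on. *)
Lemma integral_le_truncations (mu : {measure set T -> \bar R}) (h : T -> R)
    (u : nat -> R) (M : \bar R) :
  measurable_fun setT h -> (forall x, 0 <= h x)%R -> (forall n, 0 <= u n)%R ->
  {homo u : m n / (m <= n)%N >-> (m <= n)%R} ->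
  (forall x, exists n, h x <= u n)%R ->
  (forall n, \int[mu]_x (Num.min (h x) (u n))%:E <= M) ->
  \int[mu]_x (h x)%:E <= M.
Proof.
move=> mh h0 u0 homou hu intM.
pose g (n : nat) (x : T) : \bar R := (Num.min (h x) (u n) : R)%:E.
have mg n : measurable_fun setT (g n).
  by apply/measurable_EFinP; apply: measurable_minr => //; exact: measurable_cst.
have g0 n x : setT x -> 0 <= g n x by rewrite lee_fin le_min h0 u0.
have homog x : setT x -> {homo g^~ x : m n / (m <= n)%N >-> m <= n}.
  move=> _ m n mn; rewrite lee_fin le_min !ge_min lexx/=.
  by rewrite homou// orbT.
have := @monotone_convergence _ _ _ mu _ measurableT g mg g0 homog.
have -> : (fun x => limn (g^~ x)) = (fun x => (h x)%:E).
  apply/funext => x; apply/cvg_lim => //; apply: cvg_near_cst.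
  have [n hn] := hu x; exists n => // m /= nm; rewrite /g min_l//.
  exact: le_trans hn (homou _ _ nm).
move=> ->; apply: lime_le; last exact: nearW.
apply: ereal_nondecreasing_is_cvgn => m n mn.
by apply: ge0_le_integral => // x _; [exact: g0|exact: homog].
Qed.

End truncation.

(** * Borell's inequality for logarithmically concave measures *)

Section borell.
Context {R : realType} {X : tvsType R}.
Hypothesis hX : hausdorff_space X.
Implicit Types (q : X -> R).

Lemma compact_borel (K : set X) : compact K -> measurable (K : set (borel X)).
Proof. by move=> cK; apply: closed_borel; exact: compact_closed. Qed.

Lemma compact_minkowski (K1 K2 : set X) (s t : R) : compact K1 -> compact K2 ->
  compact [set s *: a + t *: b | a in K1 & b in K2].
Proof.
move=> cK1 cK2.
rewrite (_ : [set _ | _ in _ & _ in _] = (fun z => s *: z.1 + t *: z.2) @` (K1 `*` K2)).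
  apply: continuous_compact; last exact: compact_setX.
  apply: continuous_subspaceT => z.
  apply: (cvgD_tvs (fun z : X * X => s *: z.1) (fun z => t *: z.2)).
    by apply: (cvgZ_tvs (fun=> s) (fun z : X * X => z.1)); [exact: cvg_cst|exact: cvg_fst].
  by apply: (cvgZ_tvs (fun=> t) (fun z : X * X => z.2)); [exact: cvg_cst|exact: cvg_snd].
apply/seteqP; split=> [_ [a Ka [b Kb <-]]|_ [[a b] [Ka Kb] <-]].
  by exists (a, b).
by exists a => //; exists b.
Qed.

Lemma borell (nu : probability (borel X) R) q (c : R) k :
  log_concave nu -> seminorm q -> continuous q -> 0 < c ->
  (nu [set x | (c < q x)%R] <= (4^-1)%:E)%E ->
  (nu [set x | ((2 * k + 1)%:R * c < q x)%R] <= ((2^-1) ^+ k.+1)%:E)%E.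
Proof.
move=> [rad lc] [qD qZ] cq c0 nuc.
(* For [k = 0] the weight [t] below would be 1, which log-concavity excludes; there the hypothesis
   suffices because 1/4 is at most 1/2. *)
case: k => [|k].
  by rewrite muln0 add0n mul1r; apply: le_trans nuc _; rewrite lee_fin expr1; lra.
set A := [set x | _]; have mA : measurable (A : set (borel X)) by exact: borel_gt.
have mc : measurable ([set x | c < q x] : set (borel X)) by exact: borel_gt.
have mB : measurable ([set x | q x <= c] : set (borel X)) by exact: borel_le.
(* The loss 1/12 leaves [K2] with mass at least 1 - 1/4 - 1/12 = 2/3. *)
have [K2 [cK2 K2B nuK2]] := rad _ 12^-1 mB ltac:(by rewrite invr_gt0 ltr0n).
apply/lee_addgt0Pr => e e0.
have [K1 [cK1 K1A nuK1]] := rad _ _ mA e0.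
have mK1 := compact_borel _ cK1; have mK2 := compact_borel _ cK2.
have -> : A = K1 `|` (A `\` K1) by rewrite setDUK.
apply: le_trans (measureU2 _ mK1 (measurableD mA mK1)) _.
apply: leeD (ltW nuK1).
pose t : R := k.+2%:R^-1.
have k0 : (0 : R) < k.+2%:R by rewrite ltr0n.
have t01 : 0 < t < 1 by rewrite /t invr_gt0 k0 invf_lt1// ltr1n.
have [t0 t1] := andP t01.
have tk : t * k.+2%:R = 1 by rewrite /t mulVf// gt_eqF.
have lcK := lc _ _ _ cK1 cK2 t01.
set S := [set _ | _ in _ & _ in _] in lcK.
have mS : measurable (S : set (borel X)).
  by apply: compact_borel; exact: compact_minkowski.
(* The reverse triangle inequality bounds [q] from below by [t * q a - (1 - t) * q b], which exceeds
   (2c - tc) - (1 - t)c = c by the choice of [t]. *)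
have Sc : S `<=` [set x | c < q x].
  move=> _ [a K1a [b K2b <-]] /=; have /= Aa := K1A _ K1a; have /= Bb := K2B _ K2b.
  have := qD (t *: a + (1 - t) *: b) (- ((1 - t) *: b)).
  rewrite addrK -scaleNr !qZ normrN (gtr0_norm t0) gtr0_norm ?subr_gt0// => h.
  have h1 : t * ((2 * k.+1 + 1)%:R * c) < t * q a by rewrite ltr_pM2l.
  have h2 : (1 - t) * q b <= (1 - t) * c by rewrite ler_pM2l// subr_gt0.
  have h3 : t * ((2 * k.+1 + 1)%:R * c) = 2 * c - t * c.
    have -> : (2 * k.+1 + 1)%:R = 2 * k.+2%:R - 1 :> R.
      by rewrite !(natrD, natrM) -!natr1; ring.
    by rewrite mulrBl mul1r mulrBr -mulrA mulrCA [t * (_ * _)]mulrA tk mul1r.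
  lra.
have nuS : (nu S <= (4^-1)%:E)%E.
  by apply: le_trans nuc; apply: le_measure; rewrite ?inE.
have fK1 := fin_num_measure nu _ mK1; have fK2 := fin_num_measure nu _ mK2.
have K2ge : ((2 / 3)%:E <= nu K2)%E.
  have : (1%:E <= nu K2 + (12^-1)%:E + (4^-1)%:E)%E.
    rewrite -[in leLHS](@probability_setT _ _ _ nu).
    have -> : [set: borel X] = (K2 `|` ([set x | q x <= c] `\` K2)) `|` [set x | c < q x].
      rewrite setDUK//; apply/esym/seteqP; split=> // x _ /=.
      by have [?|?] := leP (q x) c; [left|right].
    have mD : measurable (([set x | q x <= c] `\` K2) : set (borel X)) by exact: measurableD.
    apply: le_trans (measureU2 _ (measurableU _ _ mK2 mD) mc) _.
    apply: leeD nuc; apply: le_trans (measureU2 _ mK2 mD) _.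
    by apply: leeD => //; exact: ltW.
  rewrite -(fineK fK2) -!EFinD !lee_fin => h; lra.
have K2le : (nu K2 <= 1)%E by exact: probability_le1.
have := le_trans lcK nuS.
rewrite -(fineK fK1) -(fineK fK2); rewrite -(fineK fK2) in K2ge K2le.
rewrite !poweR_EFin -EFinM; rewrite !lee_fin in K2ge K2le *.
set x := fine (nu K1); set y := fine (nu K2) in K2ge K2le *.
have x0 : 0 <= x by rewrite fine_ge0// measure_ge0.
(* As [y] is at most 1, lowering the exponent can only increase the power. So [y ^ (1 - t)] is at
   least 2/3, whence [x ^ t] is at most 3/8 and thus below 1/2. *)
have y1 : y <= y `^ (1 - t).
  have y0 : 0 <= y by lra.
  rewrite -[leLHS](powRr1 y0).
  by apply: ger_powR; [apply/andP; split=> //; lra|lra].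
move=> xy; have xt : x `^ t <= 2^-1.
  have : x `^ t * (2 / 3) <= 4^-1.
    by apply: le_trans xy; rewrite ler_wpM2l ?powR_ge0//; lra.
  lra.
suff : x <= (2^-1) ^+ k.+2 by rewrite -lee_fin fineK.
have -> : x = (x `^ t) ^+ k.+2.
  by rewrite -powR_mulrn ?powR_ge0// -powRrM tk powRr1.
by rewrite lerXn2r ?nnegrE ?powR_ge0//.
Qed.

End borell.

Lemma le_natr_ex {R : realType} (x : R) : exists n : nat, x <= n%:R.
Proof.
exists (Num.bound `|x|); apply: le_trans (ler_norm x) (ltW _).
exact: archi_boundP.
Qed.

(** * A universal bound on exponential integrals *)

Section exponential_moment.
Context {R : realType} {X : tvsType R}.
Hypothesis hX : hausdorff_space X.
Implicit Types (q : X -> R).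

Lemma continuous_expRM q (k : R) : continuous q -> continuous (fun x => expR (k * q x)).
Proof.
move=> cq x; apply: (@continuous_comp _ _ _ (fun x => k * q x) expR).
  apply: (@continuous_comp _ _ _ q (fun y => k * y)); first exact: cq.
  exact: mulrl_continuous.
exact: continuous_expR.
Qed.

(** The values of the exponential at the levels (2n+1)c grow by the factor 3/2 per step, while
    Borell's bound on the tails halves, so the contributions of the layers form a geometric series
    of ratio 3/4. *)
Lemma borell_expR (nu : probability (borel X) R) q (c kappa : R) :
  log_concave nu -> seminorm q -> continuous q -> 0 < c -> 0 < kappa ->
  expR (kappa * c) ^+ 2 = 3 / 2 ->
  (nu [set x | (c < q x)%R] <= (4^-1)%:E)%E ->
  (\int[nu]_x (expR (kappa * q x))%:E <= 6%:E)%E.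
Proof.
move=> lc sq cq c0 kappa0 wE nuc; set w := expR (kappa * c) in wE.
pose h x := expR (kappa * q x).
have mh : measurable_fun setT (h : borel X -> R).
  by apply: continuous_borel; exact: continuous_expRM.
have w1 : 1 < w by rewrite expR_gt1 mulr_gt0.
have w0 : 0 < w by exact: lt_trans w1.
pose u (n : nat) := w ^+ (2 * n + 1).
have uE n : u n = expR (kappa * ((2 * n + 1)%:R * c)) by rewrite /u -expRM_natl mulrCA.
have u0 n : 0 <= u n by rewrite exprn_ge0// ltW.
have hle n x : q x <= (2 * n + 1)%:R * c -> h x <= u n.
  by move=> qx; rewrite uE ler_expR ler_pM2l.
have mmin n : measurable_fun setT ((fun x => (Num.min (h x) (u n))%:E) : borel X -> \bar R).
  by apply/measurable_EFinP; apply: measurable_minr => //; exact: measurable_cst.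
have min0 n x : (0 <= (Num.min (h x) (u n))%:E)%E by rewrite lee_fin le_min expR_ge0 u0.
have mA n : measurable ([set x | (2 * n + 1)%:R * c < q x] : set (borel X)).
  exact: borel_gt.
(* The right-hand side is the partial sum of [w * (3 / 4) ^+ j] over j from 0 to [n]. *)
have bound n : (\int[nu]_x (Num.min (h x) (u n))%:E <=
    (4 * w - 3 * w * (3 / 4) ^+ n)%:E)%E.
  elim: n => [|n IH].
    have -> : 4 * w - 3 * w * (3 / 4) ^+ 0 = w by rewrite expr0; ring.
    rewrite -[leRHS]mule1 -(@probability_setT _ _ _ nu) -integral_cst//.
    apply: ge0_le_integral => //.
    by move=> x _; rewrite lee_fin ge_min /u muln0 expr1 lexx orbT.
  pose A : set (borel X) := [set x | (2 * n + 1)%:R * c < q x].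
  have mind : measurable_fun setT ((fun x => (\1_A x)%:E) : borel X -> \bar R).
    by apply/measurable_EFinP; apply: measurable_indic; exact: mA.
  have ind0 x : (0 <= (\1_A x : R)%:E)%E by rewrite lee_fin indicE.
  have mZ : measurable_fun setT
      ((fun x => ((u n.+1)%:E * (\1_A x)%:E)%E) : borel X -> \bar R).
    by apply: emeasurable_funM => //; exact: measurable_cst.
  (* Raising the truncation level from [u n] to [u n.+1] changes the function only on [A], and there
     by at most [u n.+1]. *)
  apply: (@le_trans _ _ (\int[nu]_x ((Num.min (h x) (u n))%:E +
      (u n.+1)%:E * (\1_A x)%:E)%E)%E).
    apply: ge0_le_integral => //; first exact: emeasurable_funD.
    move=> x _; rewrite -EFinM -EFinD lee_fin indicE.
    have [xA|xA] := boolP (x \in A).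
      rewrite mulr1 (le_trans (y := u n.+1)) ?ge_min ?lexx ?orbT//.
      by rewrite lerDr -lee_fin min0.
    have hx : h x <= u n.
      by apply: hle; rewrite leNgt; apply: contra xA => xA; rewrite inE.
    by rewrite mulr0 addr0 (min_l hx) ge_min lexx.
  rewrite ge0_integralD//; last by move=> x _; rewrite mule_ge0// lee_fin.
  have indE := integral_indicT nu A (mA n).
  rewrite ge0_integralZl_EFin// indE.
  apply: (@le_trans _ _ ((4 * w - 3 * w * (3 / 4) ^+ n)%:E +
      (u n.+1)%:E * ((2^-1) ^+ n.+1)%:E)%E).
    apply: leeD => //; apply: lee_wpmul2l; first by rewrite lee_fin.
    exact: borell.
  rewrite -EFinM -EFinD lee_fin /u.
  have -> : w ^+ (2 * n.+1 + 1) * 2^-1 ^+ n.+1 = w * (3 / 4) ^+ n.+1.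
    by rewrite addn1 exprS exprM wE -mulrA -exprMn; congr (_ * _ ^+ _); lra.
  by rewrite exprS; set a := _ ^+ n; lra.
apply: (@integral_le_truncations _ _ _ nu (h : borel X -> R) u) => //.
- by move=> x; exact: expR_ge0.
- by move=> m n mn; rewrite /u ler_weXn2l// ?ltW// leq_add2r leq_mul2l.
- move=> x; have [n hn] := le_natr_ex (q x / c); exists n; apply: hle.
  move: hn; rewrite ler_pdivrMr// => /le_trans; apply.
  by rewrite ler_pM2r// ler_nat addn1 ltnW// ltnS leq_pmull.
- move=> n; apply: le_trans (bound n) _; rewrite lee_fin.
  have a0 : 0 <= 3 * w * (3 / 4) ^+ n by rewrite !mulr_ge0// ?exprn_ge0 ?ltW// divr_gt0.
  (* Since [w] exceeds 1 it is at most its square; the full series [4 * w] is therefore at most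
     6. *)
  have : w <= 3 / 2 by rewrite -wE expr2 ler_peMr// ltW.
  by move: a0; move: (3 * w * _) => a a0 ?; lra.
Qed.

End exponential_moment.

(** * Truncation error in terms of the second moment *)

Section truncation_error.
Context {d : measure_display} {T : measurableType d} {R : realType}.
Variable mu : {finite_measure set T -> \bar R}.

Lemma integrable_min (h : T -> R) (N : R) :
  measurable_fun setT h -> (forall x, 0 <= h x) -> 0 <= N ->
  mu.-integrable setT (fun x => (Num.min (h x) N)%:E).
Proof.
move=> mh h0 N0; apply: (@le_integrable _ _ _ mu _ measurableT _ (EFin \o cst N)).
- by apply/measurable_EFinP; apply: measurable_minr => //; exact: measurable_cst.
- by move=> x _; rewrite /= lee_fin !ger0_norm// ?le_min ?h0// ge_min lexx orbT.
- exact: finite_measure_integrable_cst.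
Qed.

(** Where [h] exceeds [N] it is at most [h ^+ 2 / N]; integrating this gives both integrability and
    the error bound. *)
Lemma integral_truncation (h : T -> R) (M N : R) :
  measurable_fun setT h -> (forall x, 0 <= h x) -> 0 < N ->
  (\int[mu]_x (h x ^+ 2)%:E <= M%:E)%E ->
  [/\ mu.-integrable setT (EFin \o h),
      \int[mu]_x Num.min (h x) N <= \int[mu]_x h x &
      \int[mu]_x h x <= \int[mu]_x Num.min (h x) N + M / N].
Proof.
move=> mh h0 N0 hM.
have imin := integrable_min h N mh h0 (ltW N0).
have mh2 : measurable_fun setT (fun x => (h x ^+ 2)%:E).
  by apply/measurable_EFinP; exact: measurable_funX.
have ih2 : mu.-integrable setT (fun x => (h x ^+ 2)%:E).
  apply/integrableP; split=> //; apply: le_lt_trans (ltry M).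
  apply: le_trans hM; apply: ge0_le_integral => //.
    exact: measurableT_comp.
  by move=> x _; rewrite /= ger0_norm ?sqr_ge0.
have hle x : h x <= Num.min (h x) N + N^-1 * h x ^+ 2.
  have [hN|/ltW hN] := leP (h x) N.
    by rewrite lerDl mulr_ge0 ?sqr_ge0 ?invr_ge0 ?ltW.
  apply: (@le_trans _ _ (N^-1 * h x ^+ 2)); last by rewrite lerDr ltW.
  by rewrite ler_pdivlMl// expr2 ler_wpM2r.
have iZ : mu.-integrable setT (fun x => (N^-1 * h x ^+ 2)%:E).
  under eq_fun do rewrite EFinM; exact: integrableZl.
have ih : mu.-integrable setT (EFin \o h).
  apply: (@le_integrable _ _ _ mu _ measurableT _
    (fun x => (Num.min (h x) N)%:E + (N^-1 * h x ^+ 2)%:E)%E).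
  - exact/measurable_EFinP.
  - by move=> x _; rewrite -EFinD !abse_EFin lee_fin !ger0_norm// (le_trans (h0 x)).
  - exact: integrableD.
split=> //; first by apply: le_Rintegral => // x _; rewrite ge_min lexx.
apply: (@le_trans _ _ (\int[mu]_x (Num.min (h x) N + N^-1 * h x ^+ 2))).
  apply: le_Rintegral => //.
  exact: (integrableD _ imin iZ).
rewrite RintegralD// RintegralZl// lerD2l mulrC ler_pM2r ?invr_gt0//.
by rewrite -lee_fin /Rintegral fineK// integrable_fin_num.
Qed.

End truncation_error.

Lemma net_filter_proper disp (I : preorderType disp) :
  directed I -> ProperFilter (net_filter I).
Proof.
move=> [[i0] dir]; apply: filter_from_proper; last by move=> i _; exists i => /=.
apply: filter_from_filter; first by exists i0.
move=> i j _ _; have [k [ik jk]] := dir i j; exists k => //.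
by move=> l kl; split; [exact: le_trans ik kl|exact: le_trans jk kl].
Qed.

(** * From weak convergence to unbounded integrands *)

Section convergence_of_integrals.
Context {R : realType} {X : tvsType R} {disp : Order.disp_t} {I : preorderType disp}.
Hypothesis hI : directed I.
Variables (mu_ : I -> {finite_measure set (borel X) -> \bar R}).
Variable mu : {finite_measure set (borel X) -> \bar R}.
Hypothesis mu_cvg : weak_cvg mu_ mu.

Lemma weak_cvg_min (h : X -> R) (N : R) : continuous h -> (forall x, 0 <= h x) -> 0 <= N ->
  \int[mu_ i]_x Num.min (h x) N @[i --> net_filter I] --> \int[mu]_x Num.min (h x) N.
Proof.
move=> ch h0 N0; apply: mu_cvg.
  move=> x; apply: continuous_min; first exact: ch.
  exact: cst_continuous.
exists N; split; first exact: num_real.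
move=> M NM x _; rewrite /= ger0_norm ?le_min ?h0//.
by rewrite (le_trans _ (ltW NM))// ge_min lexx orbT.
Qed.

(** A Fatou-type statement: each truncation of [h] is a bounded continuous test function, so its
    bound passes to the limit, and the truncation is then removed. *)
Lemma weak_cvg_le (h : X -> R) (M : R) : continuous h -> (forall x, 0 <= h x) ->
  (\forall i \near net_filter I, (\int[mu_ i]_x (h x)%:E <= M%:E)%E) ->
  (\int[mu]_x (h x)%:E <= M%:E)%E.
Proof.
have FI := net_filter_proper _ _ hI.
move=> ch h0 hM; have mh := continuous_borel _ ch.
apply: (@integral_le_truncations _ _ _ mu (h : borel X -> R) (fun n => n%:R)) => //.
- by move=> m n mn; rewrite ler_nat.
- by move=> x; exact: le_natr_ex.
move=> n; have imin nu := integrable_min nu (h : borel X -> R) n%:R mh h0 (ler0n _ _).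
have fin_min nu := integrable_fin_num measurableT (imin nu).
rewrite -(fineK (fin_min mu)) lee_fin.
apply/ler_addgt0Pr => e e0.
have /cvgrPdist_lt/(_ _ e0) near_e := weak_cvg_min h n%:R ch h0 (ler0n _ _).
have [i [/= ie iM]] := @filter_ex _ _ FI _ (filterI near_e hM).
have : \int[mu_ i]_x Num.min (h x) n%:R <= M.
  rewrite -lee_fin /Rintegral (fineK (fin_min _)); apply: le_trans iM.
  apply: ge0_le_integral => //.
  - by move=> x _; rewrite lee_fin le_min h0 ler0n.
  - by apply/measurable_EFinP; apply: measurable_minr => //; exact: measurable_cst.
  - exact/measurable_EFinP.
  - by move=> x _; rewrite lee_fin ge_min lexx.
move: ie; rewrite /Rintegral ltr_distl => /andP[_]; lra.
Qed.

Lemma weak_cvg_integral (h : X -> R) (M : R) : continuous h -> (forall x, 0 <= h x) ->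
  (\forall i \near net_filter I, (\int[mu_ i]_x (h x ^+ 2)%:E <= M%:E)%E) ->
  [/\ (\int[mu]_x (h x)%:E < +oo)%E,
      \int[mu_ i]_x h x @[i --> net_filter I] --> \int[mu]_x h x &
      (\int[mu_ i]_x (h x)%:E)%E @[i --> net_filter I] --> (\int[mu]_x (h x)%:E)%E].
Proof.
have FI := net_filter_proper _ _ hI.
move=> ch h0 hM; have mh := continuous_borel _ ch.
have ch2 : continuous (fun x => h x ^+ 2).
  by move=> x; exact: (cvgM (ch x) (ch x)).
have muM := weak_cvg_le (fun x => h x ^+ 2) M ch2 (fun x => sqr_ge0 _) hM.
have M0 : 0 <= M.
  rewrite -lee_fin; apply: le_trans muM.
  by apply: integral_ge0 => x _; rewrite lee_fin sqr_ge0.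
have [ih _ _] := integral_truncation mu (h : borel X -> R) M 1 mh h0 ltr01 muM.
have fin_h (nu : {measure set (borel X) -> \bar R}) : nu.-integrable setT (EFin \o h) ->
    (\int[nu]_x (h x)%:E)%E \is a fin_num by exact: integrable_fin_num.
have cvgR : \int[mu_ i]_x h x @[i --> net_filter I] --> \int[mu]_x h x.
  apply/cvgrPdist_lt => e e0.
  (* Each of the two truncation errors is below e/3, leaving e/3 for weak convergence; [M + 1] keeps
     [N] positive when [M] is 0. *)
  pose N := 3 * (M + 1) / e.
  have N0 : 0 < N by rewrite !mulr_gt0 ?invr_gt0//; lra.
  have MN : M / N < e / 3.
    rewrite /N invf_div mulrA ltr_pdivrMr; last by rewrite mulr_gt0//; lra.
    have -> : e / 3 * (3 * (M + 1)) = e * (M + 1) by field.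
    by rewrite mulrC ltr_pM2l//; lra.
  have e30 : 0 < e / 3 by rewrite divr_gt0.
  have [_ mu1 mu2] := integral_truncation mu (h : borel X -> R) M N mh h0 N0 muM.
  have /cvgrPdist_lt/(_ _ e30) near_e := weak_cvg_min h N ch h0 (ltW N0).
  near=> i.
  have hMi : (\int[mu_ i]_x (h x ^+ 2)%:E <= M%:E)%E by near: i; exact: hM.
  have [_ mui1 mui2] := integral_truncation (mu_ i) (h : borel X -> R) M N mh h0 N0 hMi.
  have : `|\int[mu]_x Num.min (h x) N - \int[mu_ i]_x Num.min (h x) N| < e / 3.
    by near: i; exact: near_e.
  rewrite !ltr_distl => /andP[? ?]; apply/andP; split; lra.
split=> //; first by have := fin_h _ ih; rewrite fin_numE ltey => /andP[].
(* Convergence of the extended integrals also needs them to be eventually finite. *)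
rewrite -[X in _ --> X](fineK (fin_h _ ih)); apply/fine_cvgP; split=> //.
near=> i; apply: fin_h.
have hMi : (\int[mu_ i]_x (h x ^+ 2)%:E <= M%:E)%E by near: i; exact: hM.
by have [] := integral_truncation (mu_ i) (h : borel X -> R) M 1 mh h0 ltr01 hMi.
Unshelve. all: by end_near. Qed.

End convergence_of_integrals.

(** * Real powers and their comparison with the exponential *)

Section powers.
Context {R : realType}.

(** Near a point where [f] is positive the power is [expR (r * ln f)]. At a zero of [f] the
    logarithm is of no use, and the threshold [e ^ (1 / r)] for [f] is applied directly. *)
Lemma continuous_powR {T : topologicalType} (f : T -> R) (r : R) : 0 < r ->
  (forall x, 0 <= f x) -> continuous f -> continuous (fun x => f x `^ r).
Proof.
move=> r0 f0 cf x; have := f0 x; rewrite le_eqVlt => /predU1P[fx0|fx0].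
  rewrite /continuous_at -fx0 powR0 ?gt_eqF//; apply/cvgrPdist_lt => e e0.
  have := cf x; rewrite /continuous_at -fx0 => /cvgrPdist_lt/(_ _ (powR_gt0 r^-1 e0)).
  apply: (@filterS _ (nbhs x) _) => y /=.
  rewrite !sub0r !normrN !ger0_norm ?powR_ge0// => fy.
  have -> : e = (e `^ r^-1) `^ r by rewrite -powRrM mulVf ?gt_eqF// powRr1// ltW.
  by rewrite gt0_ltr_powR// nnegrE ?powR_ge0.
rewrite /continuous_at; have -> : f x `^ r = expR (r * ln (f x)).
  by rewrite /powR gt_eqF.
apply: (@cvg_trans _ (expR (r * ln (f y)) @[y --> x])); last first.
  apply: (@continuous_comp _ _ _ (fun y => r * ln (f y)) expR); last exact: continuous_expR.
  apply: (@continuous_comp _ _ _ (fun y => ln (f y)) (fun z => r * z));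
    last exact: mulrl_continuous.
  by apply: (@continuous_comp _ _ _ f (@ln R)); [exact: cf|exact: continuous_ln].
apply: near_eq_cvg; near=> y; rewrite /powR gt_eqF//; near: y.
exact: (cvgr_gt (f x) (cf x)).
Unshelve. all: by end_near. Qed.

(** With [a = 2 * r / kappa], [expR (kappa * x)] is the square of [expR (x / a) ^ r], and [x / a] is
    at most [expR (x / a)]. *)
Lemma powR_le_expR (x r kappa : R) : 0 <= x -> 0 < r -> 0 < kappa ->
  (x `^ r) ^+ 2 <= ((2 * r / kappa) `^ r) ^+ 2 * expR (kappa * x).
Proof.
move=> x0 r0 k0; set a := 2 * r / kappa.
have a0 : 0 < a by rewrite /a divr_gt0// mulr_gt0.
have -> : expR (kappa * x) = (expR (x / a) `^ r) ^+ 2.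
  rewrite -expRM -expRM_natl; congr expR; rewrite /a.
  by field; rewrite !gt_eqF.
rewrite -exprMn -powRM ?expR_ge0 ?(ltW a0)//.
rewrite lerXn2r ?nnegrE ?powR_ge0//; apply: ge0_ler_powR; rewrite ?nnegrE ?(ltW r0)//.
  by rewrite mulr_ge0 ?expR_ge0 ?(ltW a0).
rewrite -ler_pdivrMl// mulrC; apply: le_trans (expR_ge1Dx _).
by rewrite lerDr.
Qed.

End powers.

(** * Tail and moment bounds holding eventually along the net *)

Section moments.
Context {R : realType} {X : tvsType R} {disp : Order.disp_t} {I : preorderType disp}.
Hypothesis (hX : hausdorff_space X) (hI : directed I).
Variables (mu_ : I -> probability (borel X) R).
Variable mu : {finite_measure set (borel X) -> \bar R}.
Hypothesis mu_lc : forall i, log_concave (mu_ i).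
Hypothesis mu_cvg : weak_cvg mu_ mu.
Variable q : X -> R.
Hypotheses (sq : seminorm q) (cq : continuous q).

Lemma tail_cvg0 (e : R) : 0 < e ->
  exists2 c : R, 0 < c & (mu [set x | (c < q x)%R] < e%:E)%E.
Proof.
move=> e0; pose A (n : nat) : set (borel X) := [set x | n%:R < q x].
have mA n : measurable (A n) by exact: borel_gt.
have A0 : \bigcap_n A n = set0.
  apply/seteqP; split=> // x Ax; have [n qn] := le_natr_ex (q x).
  by have := Ax n Logic.I; rewrite /A /= ltNge qn.
have : (mu \o A) n @[n --> \oo] --> mu (\bigcap_n A n).
  apply: nonincreasing_cvg_mu => //.
  - by rewrite ltey_eq fin_num_measure.
  - by rewrite A0.
  - move=> m n mn; apply/subsetPset => x; apply: le_lt_trans.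
    by rewrite ler_nat.
rewrite A0 measure0 => /fine_cvgP[_ /cvgrPdist_lt/(_ _ e0)[n _ nP]].
(* The successor keeps the level positive. *)
exists n.+1%:R => //; have := nP n.+1 (leqnSn n);
rewrite /= sub0r normrN ger0_norm ?fine_ge0//.
by rewrite -lte_fin fineK ?fin_num_measure.
Qed.

(** The continuous function [g] below, rising from 0 at [q = c] to 1 at [q = c + 1], lies between
    the indicators of {q > c + 1} and {q > c}. It carries the tail bound e/2 of the limit over to
    the net, at the cost of another e/2. *)
Lemma tail_near (e : R) : 0 < e -> exists2 c : R, 0 < c &
  \forall i \near net_filter I, (mu_ i [set x | (c < q x)%R] <= e%:E)%E.
Proof.
have FI := net_filter_proper _ _ hI.
move=> e0; have e20 : 0 < e / 2 by rewrite divr_gt0.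
have [c c0 muc] := tail_cvg0 _ e20.
exists (c + 1); first by rewrite addr_gt0.
pose h x := Num.max (q x - c) 0.
have h0 x : 0 <= h x by rewrite le_max lexx orbT.
have ch : continuous h.
  move=> x; apply: (@continuous_max _ _ (fun x => q x - c) (cst 0));
    last exact: cst_continuous.
  by apply: cvgB; [exact: cq|exact: cvg_cst].
have mh := continuous_borel _ ch.
pose g x := Num.min (h x) 1.
have mg : measurable_fun setT ((fun x => (g x)%:E) : borel X -> \bar R).
  by apply/measurable_EFinP; apply: measurable_minr => //; exact: measurable_cst.
have g0 x : (0 <= (g x)%:E)%E by rewrite lee_fin le_min h0 ler01.
have mA a : measurable ([set x | a < q x] : set (borel X)) by exact: borel_gt.
have mI a : measurable_fun setT ((fun x => (\1_[set x | a < q x] x)%:E) : borel X -> \bar R).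
  by apply/measurable_EFinP; apply: measurable_indic; exact: mA.
have fin_g (nu : {finite_measure set (borel X) -> \bar R}) :
    (\int[nu]_x (g x)%:E)%E \is a fin_num.
  apply: integrable_fin_num => //.
  exact: (integrable_min nu (h : borel X -> R) 1 mh h0 ler01).
have int_indic (nu : {finite_measure set (borel X) -> \bar R}) a :
    (\int[nu]_x (\1_[set x | a < q x] x)%:E)%E = nu [set x | a < q x].
  exact: integral_indicT.
have gmu : \int[mu]_x g x < e / 2.
  rewrite -lte_fin /Rintegral (fineK (fin_g mu)); apply: (le_lt_trans _ muc).
  rewrite -int_indic; apply: ge0_le_integral => //.
  move=> x _; rewrite lee_fin indicE; have [xc|xc] := boolP (x \in _).
    by rewrite ge_min lexx orbT.
  have qc : q x <= c by rewrite leNgt; apply: contra xc => xc; rewrite inE.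
  by rewrite ge_min ge_max lexx subr_le0 qc.
have /cvgrPdist_lt/(_ _ e20) := weak_cvg_min mu_ mu mu_cvg h 1 ch h0 ler01.
apply: (@filterS _ (net_filter I) _) => i; rewrite ltr_distl => /andP[gi _].
apply: (@le_trans _ _ (\int[mu_ i]_x g x)%:E); last first.
  by rewrite lee_fin ltW//; move: gi gmu; rewrite /g; lra.
rewrite /Rintegral (fineK (fin_g (mu_ i))).
rewrite -(int_indic (mu_ i)); apply: ge0_le_integral => //.
move=> x _; rewrite lee_fin indicE; have [xc|xc] := boolP (x \in _); last first.
  by rewrite -lee_fin.
move: xc; rewrite inE /= => xc.
by rewrite le_min lexx andbT le_max lerBrDr addrC ltW.
Qed.

Lemma expR_near : exists2 kappa : R, 0 < kappa &
  \forall i \near net_filter I, (\int[mu_ i]_x (expR (kappa * q x))%:E <= 6%:E)%E.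
Proof.
have FI := net_filter_proper _ _ hI.
have e0 : (0 : R) < 4^-1 by rewrite invr_gt0.
have [c c0 near_c] := tail_near _ e0.
have ln0 : 0 < ln (3 / 2 : R) by rewrite ln_gt0// ltr_pdivlMr// mul1r ltr_nat.
(* This value solves [expR (kappa * c) ^+ 2 = 3 / 2], as [borell_expR] requires. *)
exists (ln (3 / 2) / (2 * c)); first by rewrite divr_gt0// mulr_gt0.
apply: (@filterS _ (net_filter I) _) near_c => i.
apply: borell_expR => //; first by rewrite divr_gt0// mulr_gt0.
rewrite -expRM_natl -[RHS]lnK ?posrE//; congr expR.
by field; rewrite gt_eqF.
Qed.

(** The square is the second moment of [q ^ r] that [weak_cvg_integral] asks for; [powR_le_expR]
    reduces it to the exponential bound. *)
Lemma moment_near (r : R) : 0 < r -> exists M : R,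
  \forall i \near net_filter I, (\int[mu_ i]_x ((q x `^ r) ^+ 2)%:E <= M%:E)%E.
Proof.
have FI := net_filter_proper _ _ hI.
move=> r0; have [kappa k0 near_k] := expR_near.
set C := ((2 * r / kappa) `^ r) ^+ 2.
have C0 : 0 <= C by rewrite sqr_ge0.
exists (C * 6); apply: (@filterS _ (net_filter I) _) near_k => i ik.
have me : measurable_fun setT ((fun x => (expR (kappa * q x))%:E) : borel X -> \bar R).
  by apply/measurable_EFinP; apply: continuous_borel; exact: continuous_expRM.
apply: (@le_trans _ _ (\int[mu_ i]_x (C%:E * (expR (kappa * q x))%:E))%E).
  apply: ge0_le_integral => //.
  - by move=> x _; rewrite lee_fin sqr_ge0.
  - apply/measurable_EFinP; apply: (@measurable_funX _ (borel X)); apply: continuous_borel.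
    by apply: continuous_powR => // x; exact: seminorm_ge0.
  - by apply: emeasurable_funM => //; exact: measurable_cst.
  - by move=> x _; rewrite -EFinM lee_fin powR_le_expR// seminorm_ge0.
rewrite ge0_integralZl_EFin//.
by rewrite (EFinM C 6); apply: lee_wpmul2l; rewrite ?lee_fin.
Qed.

End moments.

(** * Partitions of unity subordinate to a seminorm on a compact set *)

Section seminorm_partition.
Context {R : realType} {X : tvsType R}.
Variable q : X -> R.
Hypotheses (sq : seminorm q) (cq : continuous q).

(** Without a finite net the sets [far s] would generate a proper filter containing [K]; a cluster
    point [x] of it in [K] contradicts [far [:: x]]. *)
Lemma compact_seminorm_net (K : set X) (e : R) : compact K -> 0 < e ->
  exists s : seq X, forall x, K x -> exists2 y, y \in s & q (x - y) < e.
Proof.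
move=> cK e0; apply: contrapT => nos.
pose far (s : seq X) : set X := [set x | K x /\ forall y, y \in s -> e <= q (x - y)].
have far0 s : far s !=set0.
  apply: contrapT => fs0; apply: nos; exists s => x Kx.
  apply: contrapT => nearx; apply: fs0; exists x; split=> // y ys.
  by rewrite leNgt; apply/negP => qe; apply: nearx; exists y.
have FF : ProperFilter (filter_from setT far).
  apply: filter_from_proper; last by move=> s _; exact: far0.
  apply: filter_from_filter; first by exists [::].
  move=> s t _ _; exists (s ++ t) => // x [Kx st].
  by split; split=> // y ys; apply: st; rewrite mem_cat ys ?orbT.
have farK : filter_from setT far K by exists [::] => // x [].
have [x [Kx clx]] := cK _ FF farK.
have : nbhs x [set y | q (y - x) < e].
  have : q (y - x) @[y --> x] --> q (x - x).
    apply: (@continuous_comp _ _ _ (fun y => y - x) q); last exact: cq.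
    by apply: (cvgB_tvs id (fun=> x)); [exact: cvg_id|exact: cvg_cst].
  by move=> /cvgr_lt; apply; rewrite subrr seminorm0.
have : filter_from setT far (far [:: x]) by exists [:: x].
move=> /clx h /h[y [[_ /(_ x (mem_head _ _))] /=]].
by rewrite leNgt => /negP.
Qed.

Lemma continuous_bigsum {T : topologicalType} {J : Type} (s : seq J) (g : J -> T -> R) :
  (forall j, continuous (g j)) -> continuous (fun x => \sum_(j <- s) g j x).
Proof.
move=> cg; elim: s => [|j s IH].
  rewrite (_ : (fun _ => _) = cst 0); first exact: cst_continuous.
  by apply/funext => x; rewrite big_nil.
rewrite (_ : (fun _ => _) = (fun x => g j x + \sum_(i <- s) g i x)).
  by move=> x; apply: cvgD; [exact: cg|exact: IH].
by apply/funext => x; rewrite big_cons.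
Qed.

Lemma seminorm_partition (K : set X) (e : R) : compact K -> 0 < e ->
  exists (s : seq X) (phi : X -> X -> R),
  [/\ forall y, continuous (phi y),
      forall y x, 0 <= phi y x <= 2,
      forall x, \sum_(y <- s) phi y x <= 1,
      forall x, K x -> \sum_(y <- s) phi y x = 1 &
      forall y x, phi y x * q (x - y) <= phi y x * (2 * e)].
Proof.
move=> cK e0; have [s sK] := compact_seminorm_net _ _ cK e0.
(* The radius [2 * e] is twice the mesh of the net, so on [K] some tent has height at least [e]. *)
pose psi y x := Num.max (2 * e - q (x - y)) 0.
pose S x := \sum_(y <- s) psi y x.
(* Flooring the denominator at [e] keeps the quotients continuous everywhere and does not alter them
   on [K]. Tents have height at most [2 * e], hence the bound 2, valid also for [y] outside [s]. *)
pose D x := Num.max (S x) e.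
have psi0 y x : 0 <= psi y x by rewrite le_max lexx orbT.
have cpsi y : continuous (psi y).
  move=> x; apply: (@continuous_max _ _ (fun x => 2 * e - q (x - y)) (cst 0));
    last exact: cst_continuous.
  apply: cvgB; first exact: cvg_cst.
  apply: (@continuous_comp _ _ _ (fun x => x - y) q); last exact: cq.
  by apply: (cvgB_tvs id (fun=> y)); [exact: cvg_id|exact: cvg_cst].
have cD : continuous D.
  move=> x; apply: (@continuous_max _ _ S (cst e)); last exact: cst_continuous.
  exact: continuous_bigsum.
have D0 x : 0 < D x by rewrite lt_max e0 orbT.
have De x : e <= D x by rewrite le_max lexx orbT.
have sumE x : \sum_(y <- s) (psi y x / D x) = S x / D x by rewrite mulr_suml.
exists s, (fun y x => psi y x / D x); split.
- move=> y x; apply: cvgM; first exact: cpsi.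
  by apply: cvgV; [rewrite gt_eqF|exact: cD].
- move=> y x; rewrite divr_ge0 ?(ltW (D0 x))//= ler_pdivrMr//.
  rewrite ge_max mulr_ge0 ?(ltW (D0 x))// andbT.
  by have := seminorm_ge0 q (x - y) sq; have := De x; lra.
- by move=> x; rewrite sumE ler_pdivrMr// mul1r le_max lexx.
- move=> x /sK[y ys qe]; rewrite sumE.
  suff eS : e <= S x by rewrite /D (max_l eS) divff// gt_eqF// (lt_le_trans e0).
  rewrite /S (big_rem y)//= (@le_trans _ _ (psi y x))//.
    by rewrite le_max lerBrDr; apply/orP; left; move: qe; lra.
  by rewrite lerDl sumr_ge0.
- move=> y x; rewrite mulrAC [leRHS]mulrAC ler_pM2r ?invr_gt0//.
  have [->|p0] := eqVneq (psi y x) 0; first by rewrite !mul0r.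
  rewrite ler_wpM2l//; have [//|/ltW q2] := leP (q (x - y)) (2 * e).
  by move: p0; rewrite /psi max_r ?eqxx// subr_le0.
Qed.

(** By linearity the difference is the sum of [phi y x * f (x - y)] plus the missing weight times
    [f x]; domination by [q] bounds each term. *)
Lemma partition_approx (f : {scalar X}) (s : seq X) (phi : X -> X -> R) (e : R) (x : X) :
  (forall x, f x <= q x) -> (forall y, 0 <= phi y x) ->
  \sum_(y <- s) phi y x <= 1 ->
  (forall y, phi y x * q (x - y) <= phi y x * e) -> 0 <= e ->
  `|f x - \sum_(y <- s) f y * phi y x| <= e + (1 - \sum_(y <- s) phi y x) * q x.
Proof.
move=> fq phi0 phi1 phie e0.
have fqN z : `|f z| <= q z by exact: norm_dominated.
have -> : f x - \sum_(y <- s) f y * phi y x =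
    \sum_(y <- s) phi y x * f (x - y) + (1 - \sum_(y <- s) phi y x) * f x.
  under [X in _ = X + _]eq_bigr do rewrite linearB/= mulrBr [_ * f _ in X in _ - X]mulrC.
  by rewrite sumrB -mulr_suml; ring.
apply: le_trans (ler_normD _ _) _; apply: lerD; last first.
  by rewrite normrM ger0_norm ?subr_ge0// ler_wpM2l ?subr_ge0.
apply: le_trans (ler_norm_sum _ _ _) _.
apply: (@le_trans _ _ (\sum_(y <- s) phi y x * e)).
  apply: ler_sum => y _; rewrite normrM (ger0_norm (phi0 y)).
  by apply: le_trans (phie y); rewrite ler_wpM2l.
by rewrite -mulr_suml ler_piMl.
Qed.

End seminorm_partition.

(** * Approximating integrals of linear functionals by finite sums *)

Section barycenters.
Context {R : realType}.

Lemma Rintegral_sum {d} {T : measurableType d} (nu : {measure set T -> \bar R})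
    {J : Type} (s : seq J) (g : J -> T -> R) :
  (forall j, nu.-integrable setT (EFin \o g j)) ->
  nu.-integrable setT (EFin \o (fun x => \sum_(j <- s) g j x)) /\
  \int[nu]_x (\sum_(j <- s) g j x) = \sum_(j <- s) \int[nu]_x g j x.
Proof.
move=> ig.
have isum t : nu.-integrable setT (EFin \o (fun x => \sum_(j <- t) g j x)).
  rewrite (_ : _ \o _ = (fun x => \sum_(j <- t) (g j x)%:E)%E).
    by apply: integrable_sum => // j _; exact: ig.
  by apply/funext => x; rewrite /= sumEFin.
split=> //; elim: s => [|j s IH].
  by under eq_Rintegral do rewrite big_nil; rewrite Rintegral_cst// mul0r big_nil.
under eq_Rintegral do rewrite big_cons.
by rewrite RintegralD// IH big_cons.
Qed.

Context {X : tvsType R}.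

(** Integrates [partition_approx]. The right-hand side does not involve [f], which makes the
    estimate uniform over functionals dominated by [q]. *)
Lemma integral_partition (nu : {finite_measure set (borel X) -> \bar R}) (q : X -> R)
    (f : {scalar X}) (s : seq X) (phi : X -> X -> R) (e : R) :
  seminorm q -> continuous q -> (forall x, f x <= q x) ->
  (forall y, continuous (phi y)) -> (forall y x, 0 <= phi y x <= 2) ->
  (forall x, \sum_(y <- s) phi y x <= 1) ->
  (forall y x, phi y x * q (x - y) <= phi y x * e) -> 0 <= e ->
  nu.-integrable setT (fun x => (q x)%:E) ->
  `|\int[nu]_x f x - \sum_(y <- s) f y * \int[nu]_x phi y x| <=
    e * fine (nu setT) + \int[nu]_x ((1 - \sum_(y <- s) phi y x) * q x).
Proof.
move=> sq cq fq cphi phi02 phi1 phie e0 iq.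
have cf := continuous_dominated _ f sq cq fq.
have iphi y : nu.-integrable setT (EFin \o (phi y : borel X -> R)).
  apply: measurable_bounded_integrable => //.
  - by rewrite ltey_eq fin_num_measure.
  - exact: continuous_borel.
  - exists 2; split; first exact: num_real.
    move=> M M2 x _ /=; have /andP[p0 p2] := phi02 y x.
    by rewrite ger0_norm// (le_trans p2)// ltW.
have fqN z : `|f z| <= q z by exact: norm_dominated.
have ifn : nu.-integrable setT (EFin \o (f : borel X -> R)).
  apply: (@le_integrable _ _ _ nu _ measurableT _ _ _ _ iq).
    by apply/measurable_EFinP; exact: continuous_borel.
  by move=> x _; rewrite lee_fin (le_trans (fqN x))// ler_norm.
have iS y : nu.-integrable setT (EFin \o (fun x : borel X => f y * phi y x)).
  exact: (integrableZl measurableT (f y) (iphi y)).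
have [isum intsum] := Rintegral_sum nu s (fun y (x : borel X) => f y * phi y x) iS.
have cS : continuous (fun x => (1 - \sum_(y <- s) phi y x) * q x).
  move=> x; apply: cvgM; last exact: cq.
  by apply: cvgB; [exact: cvg_cst|exact: continuous_bigsum].
have iR : nu.-integrable setT (EFin \o (fun x : borel X => (1 - \sum_(y <- s) phi y x) * q x)).
  apply: (@le_integrable _ _ _ nu _ measurableT _ _ _ _ iq).
    by apply/measurable_EFinP; exact: continuous_borel.
  move=> x _; have q0 := seminorm_ge0 q x sq.
  have p0 : 0 <= \sum_(y <- s) phi y x.
    by apply: sumr_ge0 => y _; have /andP[] := phi02 y x.
  rewrite lee_fin normrM ger0_norm ?subr_ge0//.
  by rewrite ler_piMl// lerBlDr lerDl.
have -> : \sum_(y <- s) f y * \int[nu]_x phi y x =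
    \int[nu]_x \sum_(y <- s) f y * phi y x.
  rewrite intsum; apply: eq_bigr => y _; rewrite RintegralZl//; exact: iphi.
rewrite -RintegralB//.
apply: le_trans (le_normr_Rintegral _ _) _ => //.
  exact: (integrableB measurableT ifn isum).
rewrite -(@Rintegral_cst _ _ _ nu setT)// -RintegralD//;
  last exact: finite_measure_integrable_cst.
apply: le_Rintegral => //.
- by have := integrable_norm (integrableB measurableT ifn isum).
- exact: (integrableD measurableT (finite_measure_integrable_cst nu e measurableT) iR).
by move=> x _; apply: partition_approx => // y; have /andP[] := phi02 y x.
Qed.

End barycenters.

(** * Convergence of barycenters *)

Section barycenter_convergence.
Context {R : realType} {X : tvsType R} {disp : Order.disp_t} {I : preorderType disp}.
Hypothesis (hX : hausdorff_space X) (hI : directed I).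
Variables (mu_ : I -> probability (borel X) R).
Variable mu : {finite_measure set (borel X) -> \bar R}.
Hypothesis mu_lc : forall i, log_concave (mu_ i).
Hypothesis mu_radon : radon mu.
Hypothesis mu_cvg : weak_cvg mu_ mu.

(* The remainder vanishes on [K]; off [K], AM-GM gives
   [q <= t * q ^+ 2 + t^-1]. *)
Lemma integral_remainder_le (q rem : X -> R) (K : set X) (M t : R) :
  continuous q -> (forall x, 0 <= q x) -> continuous rem ->
  (forall x, 0 <= rem x <= q x) -> (forall x, K x -> rem x = 0) ->
  measurable (K : set (borel X)) -> 0 < t ->
  (\int[mu]_x (q x ^+ 2)%:E <= M%:E)%E -> (mu (~` K) <= (t ^+ 2)%:E)%E ->
  (\int[mu]_x (rem x)%:E <= (t * M + t)%:E)%E.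
Proof.
move=> cq q0 crem remq remK mK t0 qM muK.
have mq2 : measurable_fun setT ((fun x => (q x ^+ 2)%:E) : borel X -> \bar R).
  by apply/measurable_EFinP; apply: (@measurable_funX _ (borel X)); exact: continuous_borel.
have mKC : measurable ((~` K) : set (borel X)) by exact: measurableC.
have mI : measurable_fun setT ((fun x => (\1_(~` K) x)%:E) : borel X -> \bar R).
  by apply/measurable_EFinP; exact: measurable_indic.
have m1 : measurable_fun setT ((fun x => (t%:E * (q x ^+ 2)%:E)%E) : borel X -> \bar R).
  by apply: emeasurable_funM => //; exact: measurable_cst.
have m2 : measurable_fun setT
    ((fun x => ((t^-1)%:E * (\1_(~` K) x)%:E)%E) : borel X -> \bar R).
  by apply: emeasurable_funM => //; exact: measurable_cst.
have t'0 : 0 <= t^-1 by rewrite invr_ge0 ltW.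
have p1 x : (0 <= t%:E * (q x ^+ 2)%:E)%E.
  by rewrite -EFinM lee_fin mulr_ge0 ?sqr_ge0 ?(ltW t0).
have p2 x : (0 <= (t^-1)%:E * (\1_(~` K) x : R)%:E)%E.
  by rewrite -EFinM lee_fin mulr_ge0// indicE.
apply: (@le_trans _ _ (\int[mu]_x (t%:E * (q x ^+ 2)%:E + (t^-1)%:E * (\1_(~` K) x)%:E))%E).
  apply: ge0_le_integral => //.
  - by move=> x _; rewrite lee_fin; have /andP[] := remq x.
  - by apply/measurable_EFinP; exact: continuous_borel.
  - exact: emeasurable_funD.
  move=> x _; have [Kx|nKx] := pselect (K x).
    by rewrite remK//; apply: adde_ge0; [exact: p1|exact: p2].
  rewrite -!EFinM -EFinD lee_fin indicE mem_set// mulr1.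
  apply: (@le_trans _ _ (q x)); first by have /andP[] := remq x.
  rewrite -(ler_pM2l t0) mulrDr divff ?gt_eqF// mulrA -expr2 -exprMn.
  by have := sqr_ge0 (t * q x - 2^-1); set z := t * q x; rewrite sqrrB; lra.
rewrite ge0_integralD// ge0_integralZl_EFin ?(ltW t0)//; last first.
  by move=> x _; rewrite lee_fin sqr_ge0.
rewrite ge0_integralZl_EFin//.
have -> : (\int[mu]_x (\1_(~` K) x)%:E)%E = mu (~` K).
  exact: integral_indicT.
rewrite EFinD; apply: leeD.
  by rewrite EFinM; apply: lee_wpmul2l; rewrite ?lee_fin ?(ltW t0).
apply: (@le_trans _ _ ((t^-1)%:E * (t ^+ 2)%:E)%E); first exact: lee_wpmul2l.
by rewrite -EFinM lee_fin expr2 mulrA mulVf ?mul1r// gt_eqF.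
Qed.

(** Applied with [a := q]: since [q y] dominates every [f y], this one limit serves all functionals
    at once. *)
Lemma cvg_sum_dist (s : seq X) (a : X -> R) (b_ : X -> I -> R) (b : X -> R) :
  (forall y, b_ y i @[i --> net_filter I] --> b y) ->
  \sum_(y <- s) a y * `|b_ y i - b y| @[i --> net_filter I] --> 0.
Proof.
have FI := net_filter_proper _ _ hI.
move=> cb; elim: s => [|y s IH].
  rewrite (_ : (fun _ => _) = cst 0); first exact: cvg_cst.
  by apply/funext => i; rewrite big_nil.
rewrite (_ : (fun _ => _) = (fun i => a y * `|b_ y i - b y| +
    \sum_(z <- s) a z * `|b_ z i - b z|)); last by apply/funext => i; rewrite big_cons.
rewrite -[X in _ --> X](addr0 0); apply: cvgD => //.
rewrite -[X in _ --> X](mulr0 (a y)); apply: cvgM; first exact: cvg_cst.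
rewrite -[X in _ --> X](@normr0 _ R) -(subrr (b y)).
by apply: cvg_norm; apply: cvgB; [exact: cb|exact: cvg_cst].
Qed.

Lemma barycenter_seminorm_near (q : X -> R) (m_ : I -> X) (m : X) (e : R) :
  seminorm q -> continuous q ->
  (forall i, barycenter (mu_ i) (m_ i)) -> barycenter mu m -> 0 < e ->
  \forall i \near net_filter I, q (m_ i - m) < e.
Proof.
have FI := net_filter_proper _ _ hI.
move=> sq cq bm_ bm e0; have q0 x := seminorm_ge0 q x sq.
have [M Mnear] := moment_near hX hI mu_ mu mu_lc mu_cvg q sq cq 1 ltr01.
have {}Mnear : \forall i \near net_filter I, (\int[mu_ i]_x (q x ^+ 2)%:E <= M%:E)%E.
  apply: (@filterS _ (net_filter I) _) Mnear => i.
  by under eq_integral do rewrite powRr1//.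
have cq2 : continuous (fun x => q x ^+ 2) by move=> x; exact: (cvgM (cq x) (cq x)).
have muM := weak_cvg_le hI mu_ mu mu_cvg _ M cq2 (fun x => sqr_ge0 _) Mnear.
have M0 : 0 <= M.
  rewrite -lee_fin; apply: le_trans muM.
  by apply: integral_ge0 => x _; rewrite lee_fin sqr_ge0.
(* Chosen so that the bound [t * M + t] on the remainder equals e/8. *)
pose t := e / (8 * (M + 1)).
have M10 : 0 < M + 1 by lra.
have t0 : 0 < t by rewrite divr_gt0// mulr_gt0.
have tM : t * M + t = e / 8.
  by rewrite /t; field; rewrite gt_eqF//; lra.
have [K [cK _ muK]] := mu_radon setT _ measurableT (exprn_gt0 2 t0).
have mK := compact_borel hX _ cK.
pose v := fine (mu setT); have v0 : 0 <= v by rewrite fine_ge0.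
(* The error [2 * d] is integrated against [mu], of mass [v], and against [mu_ i], of mass 1;
   together these cost at most e/8. *)
pose d := e / (16 * (v + 2)).
have d0 : 0 < d by rewrite divr_gt0// mulr_gt0//; lra.
have dv : 2 * d * (v + 1) <= e / 8.
  have -> : 2 * d * (v + 1) = e / 8 * ((v + 1) / (v + 2)).
    by rewrite /d; field; rewrite gt_eqF//; lra.
  by rewrite ler_piMr ?divr_ge0 ?(ltW e0)// ler_pdivrMr; lra.
have [s [phi [cphi phi02 phi1 phiK phid]]] := seminorm_partition q sq cq K d cK d0.
pose rem x := (1 - \sum_(y <- s) phi y x) * q x.
have crem : continuous rem.
  move=> x; apply: cvgM; last exact: cq.
  by apply: cvgB; [exact: cvg_cst|exact: continuous_bigsum].
have remq x : 0 <= rem x <= q x.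
  have p0 : 0 <= \sum_(y <- s) phi y x.
    by apply: sumr_ge0 => y _; have /andP[] := phi02 y x.
  by rewrite /rem mulr_ge0 ?subr_ge0//= ler_piMl// lerBlDr lerDl.
have rem0 x : 0 <= rem x by have /andP[] := remq x.
have mux : (\int[mu]_x (rem x)%:E <= (t * M + t)%:E)%E.
  apply: (integral_remainder_le q rem K) => //.
    by move=> x Kx; rewrite /rem phiK// subrr mul0r.
  by move: muK; rewrite setTD => /ltW.
(* Nothing is known about the mass of [mu_ i] off [K]. Its remainder is controlled instead by
   convergence of the integrals of [rem], which inherits the second-moment bound of [q]. *)
have remM : \forall i \near net_filter I, (\int[mu_ i]_x (rem x ^+ 2)%:E <= M%:E)%E.
  apply: (@filterS _ (net_filter I) _) Mnear => i; apply: le_trans.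
  apply: ge0_le_integral => //.
  - by move=> x _; rewrite lee_fin sqr_ge0.
  - by apply/measurable_EFinP; apply: (@measurable_funX _ (borel X)); exact: continuous_borel.
  - by apply/measurable_EFinP; apply: (@measurable_funX _ (borel X)); exact: continuous_borel.
  - by move=> x _; rewrite lee_fin lerXn2r ?nnegrE//; have /andP[] := remq x.
have [rem_fin rem_cvg _] := weak_cvg_integral hI mu_ mu mu_cvg rem M crem rem0 remM.
have remle : \int[mu]_x rem x <= e / 8.
  rewrite -tM -lee_fin /Rintegral fineK// ge0_fin_numE//.
  by apply: integral_ge0 => x _; rewrite lee_fin.
have e80 : 0 < e / 8 by rewrite divr_gt0.
have phi_cvg y : \int[mu_ i]_x phi y x @[i --> net_filter I] --> \int[mu]_x phi y x.
  apply: mu_cvg => //; exists 2; split; first exact: num_real.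
  move=> N N2 x _ /=; have /andP[p0 p2] := phi02 y x.
  by rewrite ger0_norm// (le_trans p2)// ltW.
have sum_cvg := cvg_sum_dist s q _ _ phi_cvg.
have q_int (nu : {finite_measure set (borel X) -> \bar R}) :
    (\int[nu]_x (q x ^+ 2)%:E <= M%:E)%E -> nu.-integrable setT (fun x => (q x)%:E).
  by move=> nuM; have [] := integral_truncation nu (q : borel X -> R) M 1
    (continuous_borel q cq) q0 ltr01 nuM.
near=> i.
have Mi : (\int[mu_ i]_x (q x ^+ 2)%:E <= M%:E)%E by near: i; exact: Mnear.
(* The functional depends on [i], so the estimates that follow use only its linearity and its
   domination by [q]. *)
have [f [fq fm]] := hahn_banach q (m_ i - m) (seminorm_sublinear q sq).
have cf := continuous_dominated q f sq cq fq.
rewrite -fm linearB/= (bm_ i f cf).2 (bm f cf).2.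
have part nu := integral_partition nu q f s phi (2 * d) sq cq fq cphi phi02 phi1 phid
  (mulr_ge0 (ler0n _ 2) (ltW d0)).
have := part (mu_ i) (q_int (mu_ i) Mi); have := part mu (q_int mu muM).
rewrite -/v.
have -> : fine (mu_ i [set: borel X]) = 1 by rewrite probability_setT.
rewrite !ler_norml => /andP[mu1 mu2] /andP[mui1 mui2].
have sumle : \sum_(y <- s) f y * \int[mu_ i]_x phi y x -
    \sum_(y <- s) f y * \int[mu]_x phi y x < e / 8.
  apply: (@le_lt_trans _ _ (\sum_(y <- s) q y *
      `|\int[mu_ i]_x phi y x - \int[mu]_x phi y x|)).
    rewrite -sumrB; apply: ler_sum => y _; rewrite -mulrBr.
    apply: le_trans (ler_norm _) _; rewrite normrM ler_wpM2r//.
    exact: norm_dominated.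
  by near: i; apply: cvgr_lt sum_cvg _ e80.
have remi : \int[mu_ i]_x rem x < e / 4.
  near: i; apply: cvgr_lt rem_cvg _ _; lra.
(* The total is below e/8 for [d], e/8 and e/4 for the two remainders and e/8 for the sums, that is
   5e/8. *)
have := remle; have := remi; have := dv; rewrite /rem; lra.
Unshelve. all: by end_near. Qed.

Lemma barycenter_cvg (m_ : I -> X) (m : X) :
  (forall i, barycenter (mu_ i) (m_ i)) -> barycenter mu m ->
  m_ i @[i --> net_filter I] --> m.
Proof.
have FI := net_filter_proper _ _ hI.
move=> bm_ bm U Um.
have : nbhs (0 : X) [set z | U (z + m)].
  have : z + m @[z --> (0 : X)] --> 0 + m.
    by apply: (cvgD_tvs id (fun=> m)); [exact: cvg_id|exact: cvg_cst].
  by rewrite add0r => /(_ _ Um).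
move=> /seminorm_basis[q [sq cq qU]].
have := barycenter_seminorm_near q m_ m 1 sq cq bm_ bm ltr01.
apply: (@filterS _ (net_filter I) _) => i /qU /=.
by rewrite subrK.
Qed.

End barycenter_convergence.

Theorem theorem4p1 (R : realType) (X : tvsType R) (hX : hausdorff_space X)
    (disp : Order.disp_t) (I : preorderType disp) (hI : directed I)
    (mu_ : I -> probability (borel X) R)
    (mu : {finite_measure set (borel X) -> \bar R})
    (mu_lc : forall i, log_concave (mu_ i)) (mu_radon : radon mu)
    (mu_cvg : weak_cvg mu_ mu) :
  [/\ forall q : X -> R, seminorm q -> continuous q ->
        exists kappa : R, [/\ 0 < kappa,
          (\int[mu]_x (expR (kappa * q x))%:E < +oo)%E &
          (\int[mu_ i]_x (expR (kappa * q x))%:E)%E @[i --> net_filter I] -->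
          (\int[mu]_x (expR (kappa * q x))%:E)%E],
      forall (q : X -> R) (r : R), seminorm q -> continuous q -> 0 < r ->
        (\int[mu]_x (q x `^ r)%:E < +oo)%E /\
        (\int[mu_ i]_x (q x `^ r)%:E)%E @[i --> net_filter I] -->
        (\int[mu]_x (q x `^ r)%:E)%E &
      forall (m_ : I -> X) (m : X), (forall i, barycenter (mu_ i) (m_ i)) ->
        barycenter mu m -> m_ i @[i --> net_filter I] --> m].
Proof.
have FI := net_filter_proper _ _ hI.
split.
- move=> q sq cq; have [kappa k0 near_k] := expR_near hX hI mu_ mu mu_lc mu_cvg q sq cq.
  (* Halving the exponent turns the uniform bound at [kappa] into the second-moment bound that
     [weak_cvg_integral] needs. *)
  exists (kappa / 2); rewrite divr_gt0//.
  have ch := continuous_expRM q (kappa / 2) cq.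
  have [||] := weak_cvg_integral hI mu_ mu mu_cvg _ 6 ch; last by [].
    by move=> x; exact: expR_ge0.
  have hE x : expR (kappa / 2 * q x) ^+ 2 = expR (kappa * q x).
    by rewrite -expRM_natl; congr expR; field.
  apply: (@filterS _ (net_filter I) _) near_k => i.
  by under [in X in _ -> X]eq_integral do rewrite hE.
- move=> q r sq cq r0.
  have [M near_M] := moment_near hX hI mu_ mu mu_lc mu_cvg q sq cq r r0.
  have cr := continuous_powR q r r0 (fun x => seminorm_ge0 q x sq) cq.
  have [] := weak_cvg_integral hI mu_ mu mu_cvg _ M cr
    (fun x => powR_ge0 _ _) near_M.
  by split.
- exact: barycenter_cvg.
Qed.
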